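(* Let $n$ be a positive integer, let $x,y,z$ be complex numbers with $x+y+z=1$, and let $t$ be a complex number with $t\notin\{0,1,\dots,n\}$. Then $$\frac{(-1)^n}2\sum_{k=0}^{n-1}\binom t{k}E_k(x)E_{n-1-k}(y)=\frac 1{n-t}\sum_{k=0}^n\binom {n-t}kB_k(x)E_{n-k}(z)+\binom tn\sum_{k=0}^n\binom nk\frac {E_{k}(z)}{t-k}B_{n-k}(y),$$ $$\frac n2\binom tn\sum_{k=0}^{n-1}\binom {n-1}k\frac {E_{k}(x)}{t-k}E_{n-1-k}(y)-(-1)^nE_n(z)\binom tn\sum_{k=0}^{n-1}\frac1{t-k}=(-1)^n\sum_{k=1}^n\binom t{n-k}\frac {B_k(y)}{k}E_{n-k}(z)-\sum_{k=1}^n\binom {n-1-t}{n-k}\frac {B_k(x)}kE_{n-k}(z),$$ and $$\frac {(-1)^{n-1}}n\binom {t-1}{n-1}\sum_{k=0}^n\binom nk\frac {B_k(x)}{t-k}B_{n-k}(y)-\frac {B_n(z)}n\binom {t-1}{n-1}\sum_{k=1}^{n-1}\frac1{t-k}=\frac 1t\sum_{k=1}^{n}\binom t{n-k}\frac{B_{k}(y)}kB_{n-k}(z)+\frac {(-1)^n}{n-t}\sum_{k=1}^n\binom {n-t}{n-k}\frac{B_k(x)}kB_{n-k}(z).$$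
   Context: Bernoulli numbers are defined by $B_0=1$ and $\sum_{k=0}^n\binom{n+1}kB_k=0$ for $n\ge1$; Euler numbers by $E_0=1$ and $\sum_{0\le k\le n,\,2\mid n-k}\binom nkE_k=0$ for $n\ge1$. The Bernoulli polynomials are $B_n(x)=\sum_{k=0}^n\binom nkB_kx^{n-k}$ and the Euler polynomials are $E_n(x)=\sum_{k=0}^n\binom nk\frac{E_k}{2^k}(x-\frac12)^{n-k}$. For complex $z$ and integer $k\ge0$, $\binom zk=z(z-1)\cdots(z-k+1)/k!$ (with $\binom z0=1$). *)

(* Defs.v *)
From HB Require Import structures.
From mathcomp Require Import all_boot all_order all_algebra.
From mathcomp Require Import complex.
From mathcomp Require Import reals.
Set Implicit Arguments. Unset Strict Implicit. Unset Printing Implicit Defensive.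
Import Order.TTheory GRing.Theory Num.Theory.
Local Open Scope ring_scope.

Section Defs.
Variable F : fieldType.

(* bern_seq n = [:: B_0; ...; B_n], from B_0 = 1 and
   sum_{k=0}^{m} C(m+1,k) B_k = 0 for m >= 1, i.e.
   B_m = -(1/(m+1)) sum_{k<m} C(m+1,k) B_k. *)
Fixpoint bern_seq (n : nat) : seq F :=
  match n with
  | 0 => [:: 1]
  | m.+1 => let s := bern_seq m in
      rcons s (- ((m.+2)%:R^-1 * \sum_(k < m.+1) ('C(m.+2, k))%:R * s`_k))
  end.
Definition bernoulli (n : nat) : F := (bern_seq n)`_n.

(* euler_seq n = [:: E_0; ...; E_n], from E_0 = 1 and
   sum_{0<=k<=m, 2 | m-k} C(m,k) E_k = 0 for m >= 1, i.e.
   E_m = - sum_{k<m, 2 | m-k} C(m,k) E_k. *)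
Fixpoint euler_seq (n : nat) : seq F :=
  match n with
  | 0 => [:: 1]
  | m.+1 => let s := euler_seq m in
      rcons s (- \sum_(k < m.+1 | ~~ odd (m.+1 - k)) ('C(m.+1, k))%:R * s`_k)
  end.
Definition euler (n : nat) : F := (euler_seq n)`_n.

Definition bernoulli_poly (n : nat) (x : F) : F :=
  \sum_(k < n.+1) ('C(n, k))%:R * bernoulli k * x ^+ (n - k).

Definition euler_poly (n : nat) (x : F) : F :=
  \sum_(k < n.+1) ('C(n, k))%:R * (euler k / 2 ^+ k) * (x - 2^-1) ^+ (n - k).

Definition binomz (z : F) (k : nat) : F :=
  (\prod_(i < k) (z - i%:R)) / (k`!)%:R.

End Defs.

(* Main.v *)
Require Import Defs.
From HB Require Import structures.
From mathcomp Require Import all_boot all_order all_algebra.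
From mathcomp Require Import complex.
From mathcomp Require Import reals.
From mathcomp Require Import ring.
From Stdlib Require Import Setoid Morphisms.
Import Order.TTheory GRing.Theory Num.Theory.
Local Open Scope ring_scope.

(* Write B(a;x) and E(a;x) for the exponential generating functions of
   B_k(x) a^k and E_k(x) a^k.  Expanding e^(xa+yb) / (e^a - e^b) in two ways
   gives, for x + y + z = 1,
     (a-b) u E(a;x) E(b;y) = 2 (B(b-a;y) E(-a;z) - B(a-b;x) E(-b;z)),
     (a-b) B(a;x) B(b;y) = a B(a-b;x) B(-b;z) - b B(b-a;y) B(-a;z).
   The coefficients of u^n are homogeneous polynomial identities in a and b.
   Put (a,b) = (-X,1-X), or (a,b) = (X,1) and divide by X - 1, and apply the
   linear functional sending X^i to 1/(t-i): it sends X^m (1-X)^l to a Beta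
   value, which is a quotient of falling factorials of t.  In the case b = 1,
   the terms with B_0 leave a geometric sum, whose image is the harmonic-type
   sum. *)

(** * Truncated formal power series, represented by polynomials *)

Section FormalSeries.
Context {F : numFieldType}.
Implicit Types (p q d : {poly F}) (a b x y z t : F) (f g : nat -> F).

(** Congruence modulo ['X^N]: coefficients beyond the truncation order carry no meaning. *)
Definition eq_upto (N : nat) p q := forall i, (i < N)%N -> p`_i = q`_i.

Lemma eq_upto_refl N p : eq_upto N p p. Proof. by []. Qed.

Lemma eq_upto_sym N p q : eq_upto N p q -> eq_upto N q p.
Proof. by move=> h i /h. Qed.

Lemma eq_upto_trans N p q d : eq_upto N p q -> eq_upto N q d -> eq_upto N p d.
Proof. by move=> h k i hi; rewrite h ?k. Qed.

Lemma eq_uptoD N p p' q q' :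
  eq_upto N p p' -> eq_upto N q q' -> eq_upto N (p + q) (p' + q').
Proof. by move=> h k i hi; rewrite !coefD h ?k. Qed.

Lemma eq_uptoB N p p' q q' :
  eq_upto N p p' -> eq_upto N q q' -> eq_upto N (p - q) (p' - q').
Proof. by move=> h k i hi; rewrite !coefB h ?k. Qed.

Lemma eq_uptoM N p p' q q' :
  eq_upto N p p' -> eq_upto N q q' -> eq_upto N (p * q) (p' * q').
Proof.
move=> h k i hi; rewrite !coefM; apply: eq_bigr => j _.
rewrite h ?k //; first exact: leq_ltn_trans (leq_subr _ _) hi.
by apply: leq_trans hi; rewrite ltn_ord.
Qed.

Lemma eq_upto_mulX N p q : eq_upto N.+1 ('X * p) ('X * q) -> eq_upto N p q.
Proof. by move=> h i hi; have := h i.+1 hi; rewrite !coefXM. Qed.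

(** A nonzero constant term makes [d] a unit among power series: coefficient [i] of [d * p] is a
    nonzero multiple of coefficient [i] of [p] plus terms in lower coefficients of [p], so strong
    induction on [i] applies. *)
Lemma eq_upto_mull N d p q :
  d`_0 != 0 -> eq_upto N (d * p) (d * q) -> eq_upto N p q.
Proof.
move=> d0 h i; elim/ltn_ind: i => i IH hi.
have := h i hi; rewrite !coefM !big_ord_recl !subn0 /=.
under eq_bigr => j _.
  rewrite IH; first over.
  - by rewrite /bump leq0n add1n ltn_subrL (leq_ltn_trans _ (ltn_ord j)).
  - by apply: leq_ltn_trans hi; rewrite leq_subr.
by move/addIr/(mulfI d0).
Qed.

(* Cancellation of a factor ['X * d] with [d] invertible costs one order. *)
Lemma eq_upto_mull_ord1 N d p q :
  d`_0 = 0 -> d`_1 != 0 -> eq_upto N.+1 (d * p) (d * q) -> eq_upto N p q.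
Proof.
move=> d0 d1 h; pose d' := drop_poly 1 d.
have Ed : d = 'X * d'.
  rewrite -[LHS](poly_take_drop 1) expr1 mulrC [take_poly 1 d](_ : _ = 0) ?add0r //.
  by apply/polyP => -[|i]; rewrite coef_take_poly coef0.
apply: (@eq_upto_mull _ d'); first by rewrite coef_drop_poly.
by apply: eq_upto_mulX; rewrite !mulrA -Ed.
Qed.

(** * Exponential generating functions *)

Definition egf (N : nat) f : {poly F} := \poly_(i < N) (f i / i`!%:R).

Lemma fact_neq0 n : n`!%:R != 0 :> F.
Proof. by rewrite pnatr_eq0 -lt0n fact_gt0. Qed.

Lemma coef_egf N f i : (i < N)%N -> (egf N f)`_i = f i / i`!%:R.
Proof. by move=> hi; rewrite coef_poly hi. Qed.

Lemma bin_factF n k : (k <= n)%N ->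
  'C(n, k)%:R = n`!%:R / (k`!%:R * (n - k)`!%:R) :> F.
Proof.
move=> kn; rewrite -(bin_fact kn) !natrM mulfK //.
by rewrite mulf_neq0 ?fact_neq0.
Qed.

Lemma coef_egfM N f g i : (i < N)%N -> (egf N f * egf N g)`_i =
  \sum_(k < i.+1) f k * g (i - k)%N / (k`!%:R * (i - k)`!%:R).
Proof.
move=> hi; rewrite coefM; apply: eq_bigr => j _.
rewrite !coef_egf; first by rewrite mulf_div.
  exact: leq_ltn_trans (leq_subr _ _) hi.
by apply: leq_trans hi; rewrite ltn_ord.
Qed.

Lemma expr_split a n k : (k <= n)%N -> a ^+ n = a ^+ k * a ^+ (n - k).
Proof. by move=> kn; rewrite -exprD subnKC. Qed.

(** The factorials of the Cauchy product combine into a binomial coefficient. Above order [N] the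
    sides differ in general, since only the right one is truncated. *)
Lemma egfM N f g : eq_upto N (egf N f * egf N g)
  (egf N (fun n => \sum_(k < n.+1) 'C(n, k)%:R * (f k * g (n - k)%N))).
Proof.
move=> i hi; rewrite coef_egfM ?coef_egf // mulr_suml.
apply: eq_bigr => k _; rewrite bin_factF; last by rewrite -ltnS.
by rewrite [RHS]mulrAC [i`!%:R / _]mulrC mulfK ?fact_neq0 // mulrC.
Qed.

Definition expX N a := egf N (fun i => a ^+ i).

(** Through [egfM] this is the binomial theorem. *)
Lemma expXD N a b : eq_upto N (expX N a * expX N b) (expX N (a + b)).
Proof.
move=> i hi; rewrite (egfM _ _ _ _ hi) !coef_egf //; congr (_ / _).
rewrite addrC exprDn; apply: eq_bigr => k _.
by rewrite -[RHS]mulr_natl [a ^+ _ * _]mulrC.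
Qed.

Lemma coef0_expX N a : (expX N.+1 a)`_0 = 1.
Proof. by rewrite coef_egf // expr0 fact0 divr1. Qed.

Lemma coef1_expX N a : (expX N.+2 a)`_1 = a.
Proof. by rewrite coef_egf // expr1 factS fact0 divr1. Qed.

Lemma expX0 N : eq_upto N (expX N 0) 1.
Proof.
move=> i hi; rewrite coef_egf // coef1 expr0n.
by case: i hi => [|i] _ /=; rewrite ?fact0 ?divr1 ?mul0r.
Qed.

(** * Recurrences of the Bernoulli and Euler numbers *)

Lemma size_bern_seq n : size (bern_seq F n) = n.+1.
Proof. by elim: n => //= n IH; rewrite size_rcons IH. Qed.

(** Each step of the recursion only appends an entry, so earlier entries never change. *)
Lemma nth_bern_seq n k : (k <= n)%N -> (bern_seq F n)`_k = bernoulli F k.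
Proof.
elim: n => [|n IH]; first by rewrite leqn0 => /eqP->.
rewrite leq_eqVlt => /predU1P[->//|hk].
by rewrite /= nth_rcons size_bern_seq hk IH.
Qed.

Lemma bernoulli_rec n : (0 < n)%N ->
  \sum_(k < n.+1) 'C(n.+1, k)%:R * bernoulli F k = 0.
Proof.
case: n => // n _; rewrite big_ord_recr /= {2}/bernoulli /=.
rewrite nth_rcons size_bern_seq ltnn eqxx binSn mulrN mulVKf ?pnatr_eq0 //.
apply/eqP; rewrite subr_eq0; apply/eqP/eq_bigr => k _.
by rewrite nth_bern_seq // -ltnS.
Qed.

Lemma size_euler_seq n : size (euler_seq F n) = n.+1.
Proof. by elim: n => //= n IH; rewrite size_rcons IH. Qed.

Lemma nth_euler_seq n k : (k <= n)%N -> (euler_seq F n)`_k = euler F k.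
Proof.
elim: n => [|n IH]; first by rewrite leqn0 => /eqP->.
rewrite leq_eqVlt => /predU1P[->//|hk].
by rewrite /= nth_rcons size_euler_seq hk IH.
Qed.

Lemma euler_rec n : (0 < n)%N ->
  \sum_(k < n.+1 | ~~ odd (n - k)) 'C(n, k)%:R * euler F k = 0.
Proof.
case: n => // n _; rewrite big_mkcond big_ord_recr /= subnn /= -big_mkcond.
rewrite {2}/euler /= nth_rcons size_euler_seq ltnn eqxx binn mul1r.
apply/eqP; rewrite subr_eq0; apply/eqP/eq_bigr => k _.
by rewrite nth_euler_seq // -ltnS.
Qed.

(** * Generating functions of the Bernoulli and Euler polynomials *)

Definition berX N x a := egf N (fun k => bernoulli_poly k x * a ^+ k).
Definition eulX N x a := egf N (fun k => euler_poly k x * a ^+ k).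

Lemma berX_shift N x a : eq_upto N (berX N x a)
  (egf N (fun k => bernoulli F k * a ^+ k) * expX N (x * a)).
Proof.
move=> i hi; rewrite (egfM _ _ _ _ hi) !coef_egf //; congr (_ / _).
rewrite /bernoulli_poly mulr_suml; apply: eq_bigr => k _.
have ki : (k <= i)%N by rewrite -ltnS.
by rewrite (expr_split _ _ _ ki) exprMn; ring.
Qed.

(** The scale [a / 2] absorbs the powers of 2 in [euler_poly]; the rest is a binomial
    convolution. *)
Lemma eulX_shift N x a : eq_upto N (eulX N x a)
  (egf N (fun k => euler F k * (a / 2) ^+ k) * expX N ((x - 2^-1) * a)).
Proof.
move=> i hi; rewrite (egfM _ _ _ _ hi) !coef_egf //; congr (_ / _).
rewrite /euler_poly mulr_suml; apply: eq_bigr => k _.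
have ki : (k <= i)%N by rewrite -ltnS.
rewrite (expr_split _ _ _ ki) !exprMn exprVn; ring.
Qed.

Lemma bernoulli_egf N a : eq_upto N
  (egf N (fun k => bernoulli F k * a ^+ k) * (expX N a - 1)) (a%:P * 'X).
Proof.
move=> i hi; rewrite mulrBr mulr1 coefB (egfM _ _ _ _ hi) !coef_egf //.
rewrite big_ord_recr /= subnn binn expr0 mulr1 mul1r mulrDl addrK.
rewrite coefCM coefX.
(* The term [k = i] has cancelled against [- 1]. The remaining sum over [k < i] is empty for
   [i = 0], is the [B_0] term for [i = 1], and vanishes by the recurrence from [i = 2] on. *)
case: i hi => [|[|i]] hi; first by rewrite big_ord0 mul0r mulr0.
  rewrite big_ord1 bin0 subn0 /bernoulli /= factS fact0.
  by rewrite expr0 expr1 divr1 !mul1r mulr1.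
rewrite [\sum_(k < _) _](_ : _ = a ^+ i.+2 *
  \sum_(k < i.+2) 'C(i.+2, k)%:R * bernoulli F k).
  by rewrite bernoulli_rec // mulr0 mul0r mulr0.
rewrite mulr_sumr; apply: eq_bigr => k _.
have ki : (k <= i.+2)%N by rewrite ltnW.
by rewrite (expr_split _ _ _ ki); ring.
Qed.

(** Adding the exponential at [- a] doubles the terms with [i - k] even and kills the others, which
    leaves the recurrence of the Euler numbers. *)
Lemma euler_egf N a : eq_upto N
  (egf N (fun k => euler F k * a ^+ k) * (expX N a + expX N (- a))) 2%:P.
Proof.
move=> i hi; rewrite mulrDr coefD !(egfM _ _ _ _ hi) !coef_egf // -mulrDl.
rewrite -big_split /= coefC.
rewrite [\sum_(k < _) _](_ : _ = a ^+ i *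
  (2 * \sum_(k < i.+1 | ~~ odd (i - k)) 'C(i, k)%:R * euler F k)).
  case: i hi => [|i] hi; last by rewrite euler_rec // !mulr0 mul0r.
  rewrite big_mkcond big_ord1 /= /euler /= bin0 expr0 fact0.
  by rewrite divr1 !mul1r mulr1.
rewrite [in RHS]big_mkcond !mulr_sumr; apply: eq_bigr => k _.
have ki : (k <= i)%N by rewrite -ltnS.
rewrite (expr_split _ _ _ ki) [(- a) ^+ _]exprNn -signr_odd.
by case: odd => /=; rewrite ?expr0 ?expr1; ring.
Qed.

Lemma berXE N x a :
  eq_upto N (berX N x a * (expX N a - 1)) ((a%:P * 'X) * expX N (x * a)).
Proof.
apply: eq_upto_trans (eq_uptoM _ _ _ _ _ (berX_shift N x a) (eq_upto_refl _ _)) _.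
rewrite mulrAC.
exact: eq_uptoM (bernoulli_egf _ _) (eq_upto_refl _ _).
Qed.

(** Since [e^a + 1 = e^(a/2) (e^(a/2) + e^(-a/2))], the factor [e^(a/2)] undoes the shift by one
    half and [euler_egf] applies at [a / 2]. *)
Lemma eulXE N x a :
  eq_upto N (eulX N x a * (expX N a + 1)) (2%:P * expX N (x * a)).
Proof.
apply: eq_upto_trans (eq_uptoM _ _ _ _ _ (eulX_shift N x a) (eq_upto_refl _ _)) _.
apply: (@eq_upto_trans _ _
  (egf N (fun k => euler F k * (a / 2) ^+ k) *
   (expX N (a / 2) + expX N (- (a / 2))) * expX N (x * a))).
  rewrite -!mulrA; apply: eq_uptoM => //.
  rewrite mulrDr mulr1 [X in eq_upto _ _ X]mulrDl; apply: eq_uptoD.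
    apply: eq_upto_trans (expXD _ _ _) _; apply: eq_upto_sym.
    rewrite [X in eq_upto _ _ (expX N X)](_ : _ = a / 2 + x * a).
      exact: expXD.
    by field.
  apply: eq_upto_sym.
  rewrite [X in eq_upto _ _ (expX N X)](_ : _ = - (a / 2) + x * a).
    exact: expXD.
  by field.
by apply: eq_uptoM (euler_egf _ _) (eq_upto_refl _ _).
Qed.

Lemma expXN N a : eq_upto N (expX N a * expX N (- a)) 1.
Proof. by apply: eq_upto_trans (expXD _ _ _) _; rewrite subrr; exact: expX0. Qed.

(** Multiply [berXE] at [- a] by [- e^a]. This is the reflection of [x] to [1 - x], and it keeps the
    denominator [e^a - 1] for the argument [- a]. *)
Lemma berXNE N x a : eq_upto N (berX N x (- a) * (expX N a - 1))
  ((a%:P * 'X) * expX N ((1 - x) * a)).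
Proof.
have h := eq_uptoM _ _ _ _ _ (berXE N x (- a)) (eq_upto_refl N (- expX N a)).
apply: eq_upto_trans (eq_upto_trans _ _ _ _ h _).
  rewrite -mulrA; apply: eq_uptoM => //.
  rewrite mulrN mulrBl mul1r opprB.
  by apply: eq_uptoB => //; rewrite mulrC; exact/eq_upto_sym/expXN.
rewrite [X in eq_upto _ X _](_ : _ =
  a%:P * 'X * (expX N (x * - a) * expX N a)); last by rewrite polyCN; ring.
apply: eq_uptoM => //.
by rewrite [(1 - x) * a](_ : _ = x * - a + a); [exact: expXD | ring].
Qed.

Lemma eulXNE N x a : eq_upto N (eulX N x (- a) * (expX N a + 1))
  (2%:P * expX N ((1 - x) * a)).
Proof.
have h := eq_uptoM _ _ _ _ _ (eulXE N x (- a)) (eq_upto_refl N (expX N a)).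
apply: eq_upto_trans (eq_upto_trans _ _ _ _ h _).
  rewrite -mulrA; apply: eq_uptoM => //.
  rewrite mulrDl mul1r addrC.
  by apply: eq_uptoD => //; rewrite mulrC; exact/eq_upto_sym/expXN.
rewrite -mulrA; apply: eq_uptoM => //.
by rewrite [(1 - x) * a](_ : _ = x * - a + a); [exact: expXD | ring].
Qed.

End FormalSeries.

(** * The two identities in [a] and [b] *)

Section MasterIdentities.
Context {F : numFieldType}.
Implicit Types (p q d : {poly F}) (a b x y z t : F) (f g : nat -> F).

(** These instances let [rewrite] replace a series by a congruent one inside sums and products. *)
#[local] Instance eq_upto_equiv N : Equivalence (@eq_upto F N).
Proof.
split; [exact: eq_upto_refl|exact: eq_upto_sym|exact: eq_upto_trans].
Qed.
#[local] Instance eq_uptoD_proper N :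
  Proper (eq_upto N ==> eq_upto N ==> eq_upto N) (+%R : {poly F} -> _ -> _).
Proof. by move=> p p' hp q q' hq; exact: eq_uptoD. Qed.
#[local] Instance eq_uptoN_proper N :
  Proper (eq_upto N ==> eq_upto N) (-%R : {poly F} -> _).
Proof. by move=> p p' hp i hi; rewrite !coefN hp. Qed.
#[local] Instance eq_uptoM_proper N :
  Proper (eq_upto N ==> eq_upto N ==> eq_upto N) ( *%R : {poly F} -> _ -> _).
Proof. by move=> p p' hp q q' hq; exact: eq_uptoM. Qed.

(** All denominators are cleared by multiplying with [(e^(a-b) - 1) (e^a + 1) (e^b + 1)]. Only the
    first factor vanishes at 0, to order one, so a single order of precision is lost. *)
Lemma master_eul N a b x y z : a != b -> x + y + z = 1 ->
  eq_upto N.+1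
    ((a - b)%:P * 'X * (eulX N.+2 x a * eulX N.+2 y b))
    (2%:P * (berX N.+2 y (- (a - b)) * eulX N.+2 z (- a)
             - berX N.+2 x (a - b) * eulX N.+2 z (- b))).
Proof.
move=> ab xyz; set M := N.+2.
have coef0D1 c : (expX M c + 1)`_0 != 0.
  by rewrite coefD coef0_expX coef1 -[1 + 1]/2%:R pnatr_eq0.
apply: (@eq_upto_mull_ord1 _ _ (expX M (a - b) - 1)).
- by rewrite coefB coef0_expX coef1 subrr.
- by rewrite coefB coef1_expX coef1 subr0 subr_eq0.
apply: (@eq_upto_mull _ _ (expX M a + 1)) => //.
apply: (@eq_upto_mull _ _ (expX M b + 1)) => //.
set A := expX M a; set B := expX M b; set C := expX M (a - b).
set c := (a - b)%:P * 'X.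
set U := eulX _ _ _; set V := eulX _ _ _; set Q := berX _ _ _.
set Z2 := eulX _ _ _; set P := berX _ _ _; set Z1 := eulX _ _ _.
rewrite [X in eq_upto _ X _](_ : _ =
  c * (C - 1) * ((U * (A + 1)) * (V * (B + 1)))); last by ring.
rewrite [X in eq_upto _ _ X](_ : _ =
  2%:P * ((Q * (C - 1)) * (Z2 * (A + 1)) * (B + 1) -
  (P * (C - 1)) * (Z1 * (B + 1)) * (A + 1))); last by ring.
rewrite /U /V /Q /P /Z1 /Z2 !eulXE !eulXNE berXE berXNE -/c.
(* Because [x + y + z = 1], every product of exponentials that occurs is [G] or [G * C]. *)
pose G := expX M (x * a + y * b).
have h1 : eq_upto M (expX M (x * a) * expX M (y * b)) G by exact: expXD.
have h2 : eq_upto M (expX M ((1 - y) * (a - b)) * expX M ((1 - z) * a)) (G * C).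
  have -> : z = 1 - x - y by rewrite -xyz; ring.
  rewrite /G /C !expXD.
  by rewrite [X in eq_upto _ (expX _ X)](_ : _ = x * a + y * b + (a - b)); last ring.
have h3 : eq_upto M (expX M (x * (a - b)) * expX M ((1 - z) * b)) G.
  have -> : z = 1 - x - y by rewrite -xyz; ring.
  rewrite /G !expXD.
  by rewrite [X in eq_upto _ (expX _ X)](_ : _ = x * a + y * b); last ring.
have h4 : eq_upto M (C * B) A by rewrite expXD subrK.
rewrite [X in eq_upto _ X _](_ : _ = 4%:P * c * (C - 1) *
  (expX M (x * a) * expX M (y * b))); last by ring.
rewrite [X in eq_upto _ _ X](_ : _ = 4%:P * c * (
  (expX M ((1 - y) * (a - b)) * expX M ((1 - z) * a)) * (B + 1) -
  (expX M (x * (a - b)) * expX M ((1 - z) * b)) * (A + 1))); last by ring.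
rewrite h1 h2 h3.
rewrite [X in eq_upto _ _ X](_ : _ = 4%:P * c * (
  G * (C * B) + G * C - G * (A + 1))); last by ring.
(* As [C * B] is [A], the bracket collapses to [(C - 1) * G]. *)
by rewrite h4 [X in eq_upto _ _ X](_ : _ = 4%:P * c * (C - 1) * G); last by ring.
Qed.

(** Here all three denominators vanish at 0 to order one, which costs three orders; the nonvanishing
    of [a], [b] and [a - b] keeps their linear coefficients nonzero. *)
Lemma master_ber N a b x y z : a != 0 -> b != 0 -> a != b -> x + y + z = 1 ->
  eq_upto N.+1
    ((a - b)%:P * (berX N.+4 x a * berX N.+4 y b))
    (a%:P * (berX N.+4 x (a - b) * berX N.+4 z (- b))
     - b%:P * (berX N.+4 y (- (a - b)) * berX N.+4 z (- a))).
Proof.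
move=> a0 b0 ab xyz; set M := N.+4.
have coef0B1 c : (expX M c - 1)`_0 = 0.
  by rewrite coefB coef0_expX coef1 subrr.
have coef1B1 c : c != 0 -> (expX M c - 1)`_1 != 0.
  by rewrite coefB coef1_expX coef1 subr0.
apply: (@eq_upto_mull_ord1 _ _ (expX M (a - b) - 1)) => //.
  by apply: coef1B1; rewrite subr_eq0.
apply: (@eq_upto_mull_ord1 _ _ (expX M a - 1)) => //; first exact: coef1B1.
apply: (@eq_upto_mull_ord1 _ _ (expX M b - 1)) => //; first exact: coef1B1.
set A := expX M a; set B := expX M b; set C := expX M (a - b).
set U := berX _ _ _; set V := berX _ _ _; set P := berX _ _ _.
set Z1 := berX _ _ _; set Q := berX _ _ _; set Z2 := berX _ _ _.
rewrite [X in eq_upto _ X _](_ : _ =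
  (a - b)%:P * (C - 1) * ((U * (A - 1)) * (V * (B - 1)))); last by ring.
rewrite [X in eq_upto _ _ X](_ : _ =
  a%:P * ((P * (C - 1)) * (Z1 * (B - 1)) * (A - 1)) -
  b%:P * ((Q * (C - 1)) * (Z2 * (A - 1)) * (B - 1))); last by ring.
rewrite /U /V /Q /P /Z1 /Z2 !berXE !berXNE.
pose G := expX M (x * a + y * b).
have h1 : eq_upto M (expX M (x * a) * expX M (y * b)) G by exact: expXD.
have h2 : eq_upto M (expX M ((1 - y) * (a - b)) * expX M ((1 - z) * a)) (G * C).
  have -> : z = 1 - x - y by rewrite -xyz; ring.
  rewrite /G /C !expXD.
  by rewrite [X in eq_upto _ (expX _ X)](_ : _ = x * a + y * b + (a - b)); last ring.
have h3 : eq_upto M (expX M (x * (a - b)) * expX M ((1 - z) * b)) G.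
  have -> : z = 1 - x - y by rewrite -xyz; ring.
  rewrite /G !expXD.
  by rewrite [X in eq_upto _ (expX _ X)](_ : _ = x * a + y * b); last ring.
have h4 : eq_upto M (C * B) A by rewrite expXD subrK.
pose c : {poly F} := (a - b)%:P * a%:P * b%:P * 'X ^+ 2.
rewrite [X in eq_upto _ X _](_ : _ = c * (C - 1) *
  (expX M (x * a) * expX M (y * b))); last by rewrite /c; ring.
rewrite [X in eq_upto _ _ X](_ : _ = c * (
  (expX M (x * (a - b)) * expX M ((1 - z) * b)) * (A - 1) -
  (expX M ((1 - y) * (a - b)) * expX M ((1 - z) * a)) * (B - 1)));
  last by rewrite /c; ring.
rewrite h1 h2 h3.
rewrite [X in eq_upto _ _ X](_ : _ = c * (
  G * (A - 1) - G * (C * B) + G * C)); last by ring.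
by rewrite h4 [X in eq_upto _ _ X](_ : _ = c * (C - 1) * G); last by ring.
Qed.

End MasterIdentities.

(** * Specialisation to polynomial identities in one variable *)

Section PolyIdentities.
Context {F : numFieldType}.
Implicit Types (p q : {poly F}) (a b x y z t : F) (s : seq F).

(** The difference, multiplied by ['X - c] for each exceptional [c], vanishes everywhere; in
    characteristic zero the naturals supply more roots than its degree allows. *)
Lemma poly_eq_cofinite s p q : (forall a, a \notin s -> p.[a] = q.[a]) -> p = q.
Proof.
move=> h; pose r := (p - q) * \prod_(c <- s) ('X - c%:P).
have r0 : r = 0.
  apply: (@roots_geq_poly_eq0 _ r [seq i%:R | i <- iota 0 (size r)]).
  - apply/allP => a _; rewrite /root /r hornerM.
    have [as_|/h eqa] := boolP (a \in s); last by rewrite hornerD hornerN eqa subrr mul0r.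
    have /eqP -> : root (\prod_(c <- s) ('X - c%:P)) a by rewrite root_prod_XsubC.
    by rewrite mulr0.
  - by rewrite map_inj_uniq ?iota_uniq // => i j /eqP; rewrite eqr_nat => /eqP.
  - by rewrite size_map size_iota.
have /eqP := r0; rewrite mulf_eq0 subr_eq0 => /orP[/eqP //|].
by rewrite (negPf (monic_neq0 (monic_prod_XsubC _ _ _))).
Qed.

(** Coefficient of ['X^n] in [master_eul]; the factor ['X] on the left lowers the index there to
    [n.-1]. *)
Lemma coef_eul_eul n a b x y z : (0 < n)%N -> a != b -> x + y + z = 1 ->
  (a - b) * \sum_(k < n) euler_poly k x * a ^+ k *
      (euler_poly (n.-1 - k) y * b ^+ (n.-1 - k)) /
      (k`!%:R * (n.-1 - k)`!%:R) =
  2 * (\sum_(k < n.+1) bernoulli_poly k y * (- (a - b)) ^+ k *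
        (euler_poly (n - k) z * (- a) ^+ (n - k)) / (k`!%:R * (n - k)`!%:R) -
       \sum_(k < n.+1) bernoulli_poly k x * (a - b) ^+ k *
        (euler_poly (n - k) z * (- b) ^+ (n - k)) / (k`!%:R * (n - k)`!%:R)).
Proof.
case: n => // n _ ab xyz.
have := master_eul n.+1 _ _ _ _ _ ab xyz n.+1 (ltnSn _).
rewrite -mulrA !coefCM coefXM coefB /eulX /berX !coef_egfM //.
exact: leq_trans (leqnSn _) _.
Qed.

Lemma coef_ber_ber n a b x y z :
  a != 0 -> b != 0 -> a != b -> x + y + z = 1 ->
  (a - b) * \sum_(k < n.+1) bernoulli_poly k x * a ^+ k *
      (bernoulli_poly (n - k) y * b ^+ (n - k)) / (k`!%:R * (n - k)`!%:R) =
  a * (\sum_(k < n.+1) bernoulli_poly k x * (a - b) ^+ k *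
      (bernoulli_poly (n - k) z * (- b) ^+ (n - k)) / (k`!%:R * (n - k)`!%:R)) -
  b * (\sum_(k < n.+1) bernoulli_poly k y * (- (a - b)) ^+ k *
      (bernoulli_poly (n - k) z * (- a) ^+ (n - k)) / (k`!%:R * (n - k)`!%:R)).
Proof.
move=> a0 b0 ab xyz.
have := master_ber n _ _ _ _ _ a0 b0 ab xyz n (ltnSn _).
by rewrite coefB !coefCM /berX !coef_egfM // ltnW // ltnW // ltnW.
Qed.

Lemma bernoulli_poly0 x : bernoulli_poly 0 x = 1.
Proof. by rewrite /bernoulli_poly big_ord1 bin0 expr0 !mulr1. Qed.

Let horner1 a : (1 : {poly F}).[a] = 1. Proof. exact: hornerC. Qed.

(* Unlike [hornerE], this does not reassociate products. *)
Let horner_noassocE := (hornerZ, hornerM, horner_exp, hornerXn, hornerX,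
  hornerD, hornerN, horner1).

(** Taking [a = - 'X] and [b = 1 - 'X] makes [a - b] equal to -1, so the Bernoulli terms contribute
    only signs and no point has to be excluded. *)
Lemma poly_eul_eul_antidiag n x y z : (0 < n)%N -> x + y + z = 1 ->
  \sum_(k < n) ((-1) ^+ k.+1 * euler_poly k x * euler_poly (n.-1 - k) y /
      (k`!%:R * (n.-1 - k)`!%:R)) *: ('X^k * (1 - 'X) ^+ (n.-1 - k)) =
  2 *: (\sum_(k < n.+1) (bernoulli_poly k y * euler_poly (n - k) z /
          (k`!%:R * (n - k)`!%:R)) *: 'X^(n - k) -
        \sum_(k < n.+1) ((-1) ^+ n * bernoulli_poly k x * euler_poly (n - k) z /
          (k`!%:R * (n - k)`!%:R)) *: (1 - 'X) ^+ (n - k)) :> {poly F}.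
Proof.
move=> n0 xyz; apply: (@poly_eq_cofinite [::]) => a _.
have ab : - a != 1 - a.
  by rewrite -subr_eq0 [_ - _](_ : _ = -1) ?oppr_eq0 ?oner_neq0 //; ring.
have := coef_eul_eul _ _ _ _ _ _ n0 ab xyz.
rewrite [- a - _](_ : _ = -1); last by ring.
rewrite mulN1r -sumrN => h.
rewrite hornerZ hornerD hornerN !horner_sum.
transitivity (\sum_(i < n)
  - (euler_poly i x * (- a) ^+ i *
     (euler_poly (n.-1 - i) y * (1 - a) ^+ (n.-1 - i)) /
     (i`!%:R * (n.-1 - i)`!%:R))).
  apply: eq_bigr => k _; rewrite !horner_noassocE exprS [(- a) ^+ _]exprNn; ring.
rewrite h; congr (_ * (_ - _)); apply: eq_bigr => k _; rewrite !horner_noassocE.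
  by rewrite !opprK expr1n; ring.
have kn : (k <= n)%N by rewrite -ltnS.
rewrite [(- (1 - a)) ^+ _]exprNn.
by rewrite (expr_split (-1) _ _ kn); ring.
Qed.

(** Take [a = 'X], [b = 1] and divide by ['X - 1]. Every term with [B_k], [k > 0], contains this
    factor; the two [B_0] terms combine to a multiple of ['X^n - 1], whose quotient is the geometric
    sum. The index [k] of the last two sums stands for [B_(k+1)]. *)
Lemma poly_eul_eul n x y z : (0 < n)%N -> x + y + z = 1 ->
  \sum_(k < n) (euler_poly k x * euler_poly (n.-1 - k) y /
      (k`!%:R * (n.-1 - k)`!%:R)) *: 'X^k =
  2 *: (((-1) ^+ n * euler_poly n z / n`!%:R) *: \sum_(k < n) 'X^k -
        \sum_(k < n) ((-1) ^+ (n - k.+1) * bernoulli_poly k.+1 y *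
            euler_poly (n - k.+1) z / (k.+1`!%:R * (n - k.+1)`!%:R)) *:
          ('X^(n - k.+1) * (1 - 'X) ^+ k) -
        \sum_(k < n) ((-1) ^+ n.-1 * bernoulli_poly k.+1 x *
            euler_poly (n - k.+1) z / (k.+1`!%:R * (n - k.+1)`!%:R)) *:
          (1 - 'X) ^+ k) :> {poly F}.
Proof.
move=> n0 xyz; apply: (@poly_eq_cofinite [:: 1]) => a; rewrite inE => ab.
have ab1 : a - 1 != 0 by rewrite subr_eq0.
apply: (mulfI ab1).
rewrite hornerZ hornerD hornerN hornerD hornerN hornerZ !horner_sum.
set S1 := (X in _ = _ * (_ * (_ * X - _ - _))).
set S2 := (X in _ = _ * (_ * (_ - X - _))).
set S3 := (X in _ = _ * (_ * (_ - _ - X))).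
set c := (X in _ = _ * (_ * (X * _ - _ - _))).
transitivity (2 * (c * ((a - 1) * S1) - (a - 1) * S2 - (a - 1) * S3));
  last by ring.
have -> : (a - 1) * S1 = a ^+ n - 1.
  by rewrite subrX1; congr (_ * _); apply: eq_bigr => k _; rewrite !horner_noassocE.
have := coef_eul_eul _ _ _ _ _ _ n0 ab xyz.
rewrite ![in X in _ = X]big_ord_recl => h.
rewrite [X in _ * X](_ : _ = \sum_(k < n) euler_poly k x * a ^+ k *
      (euler_poly (n.-1 - k) y * 1 ^+ (n.-1 - k)) /
      (k`!%:R * (n.-1 - k)`!%:R)); last first.
  by apply: eq_bigr => k _; rewrite !horner_noassocE expr1n; ring.
rewrite h {h} /S2 /S3 !mulr_sumr; congr (_ * _).
(* Pairs the two [B_0] terms, [u] and [w], apart from the tails. *)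
have sub_split (u v w r : F) : u + v - (w + r) = u - w + (v - r) by ring.
rewrite sub_split -[RHS]addrA; congr (_ + _).
  rewrite /= !bernoulli_poly0 !subn0 !expr0 fact0 !mul1r [(- a) ^+ _]exprNn /c; ring.
rewrite -!sumrN; congr (_ + _); apply: eq_bigr => k _;
  rewrite !horner_noassocE /= /bump add1n.
  by rewrite [(- a) ^+ _]exprNn opprB exprS; ring.
(* The sign [(-1)^(n-1)] is [(-1)^k] from turning ['X - 1] into [1 - 'X], times [(-1)^(n-k-1)] from
   [- b = -1]. *)
have -> : n.-1 = (k + (n - k.+1))%N by rewrite -{1}(subnKC (ltn_ord k)) addSn.
rewrite -[a - 1]opprB exprS exprD [(- (1 - a)) ^+ _]exprNn; ring.
Qed.

(** Again [a = 'X], [b = 1], divided by ['X - 1]. The outer factors [a] and [b] turn the [B_0] terms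
    into a multiple of ['X^n - 'X], so the geometric sum starts at ['X]. The point 0 is excluded
    because [coef_ber_ber] requires [a != 0]. *)
Lemma poly_ber_ber n x y z : (0 < n)%N -> x + y + z = 1 ->
  \sum_(k < n.+1) (bernoulli_poly k x * bernoulli_poly (n - k) y /
      (k`!%:R * (n - k)`!%:R)) *: 'X^k =
  \sum_(k < n) ((-1) ^+ n.-1 * bernoulli_poly k.+1 x *
      bernoulli_poly (n - k.+1) z / (k.+1`!%:R * (n - k.+1)`!%:R)) *:
    ('X^1 * (1 - 'X) ^+ k) +
  \sum_(k < n) ((-1) ^+ (n - k.+1) * bernoulli_poly k.+1 y *
      bernoulli_poly (n - k.+1) z / (k.+1`!%:R * (n - k.+1)`!%:R)) *:
    ('X^(n - k.+1) * (1 - 'X) ^+ k) -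
  ((-1) ^+ n * bernoulli_poly n z / n`!%:R) *: \sum_(k < n.-1) 'X^(k.+1)
    :> {poly F}.
Proof.
move=> n0 xyz; apply: (@poly_eq_cofinite [:: 0; 1]) => a.
rewrite !inE negb_or => /andP[a0 ab].
have ab1 : a - 1 != 0 by rewrite subr_eq0.
apply: (mulfI ab1).
rewrite !hornerD hornerN hornerZ !horner_sum.
set S1 := (X in _ = _ * (X + _ - _)).
set S2 := (X in _ = _ * (_ + X - _)).
set S3 := (X in _ = _ * (_ + _ - _ * X)).
set c := (X in _ = _ * (_ + _ - X * _)).
transitivity ((a - 1) * S1 + (a - 1) * S2 - c * ((a - 1) * S3)); last by ring.
have -> : (a - 1) * S3 = a ^+ n - a.
  rewrite -[in a ^+ n](prednK n0) exprS -[X in _ = _ - X]mulr1 -mulrBr subrX1 mulrCA.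
  congr (_ * _); rewrite mulr_sumr.
  by apply: eq_bigr => k _; rewrite !horner_noassocE exprS.
have := coef_ber_ber n _ _ _ _ _ a0 (oner_neq0 _) ab xyz.
rewrite ![in X in _ = X]big_ord_recl => h.
rewrite [X in _ * X](_ : _ = \sum_(k < n.+1) bernoulli_poly k x * a ^+ k *
      (bernoulli_poly (n - k) y * 1 ^+ (n - k)) /
      (k`!%:R * (n - k)`!%:R)); last first.
  by apply: eq_bigr => k _; rewrite !horner_noassocE expr1n; ring.
have sub_split (u v w r : F) :
  a * (u + v) - 1 * (w + r) = a * v - 1 * r + (a * u - w) by ring.
rewrite h {h} sub_split /S1 /S2; congr (_ + _).
  rewrite !mulr_sumr -sumrN; congr (_ + _); apply: eq_bigr => k _;
    rewrite !horner_noassocE /= /bump add1n.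
    have -> : n.-1 = (k + (n - k.+1))%N by rewrite -{1}(subnKC (ltn_ord k)) addSn.
    rewrite -[a - 1]opprB exprS exprD [(- (1 - a)) ^+ _]exprNn; ring.
  by rewrite [(- a) ^+ _]exprNn opprB exprS; ring.
rewrite /= !bernoulli_poly0 !subn0 !expr0 fact0 !mul1r [(- a) ^+ _]exprNn /c; ring.
Qed.

End PolyIdentities.

(** * Falling factorials and the functional sending ['X^i] to [1 / (t - i)] *)

Section BetaFunctional.
Context {F : numFieldType}.
Implicit Types (p q : {poly F}) (a b c x y z s t : F).

Definition ffactF t k := \prod_(i < k) (t - i%:R).

Lemma binomzE t k : binomz t k = ffactF t k / k`!%:R.
Proof. by []. Qed.

Lemma ffactF0 t : ffactF t 0 = 1. Proof. exact: big_ord0. Qed.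

Lemma ffactFSr t k : ffactF t k.+1 = ffactF t k * (t - k%:R).
Proof. by rewrite /ffactF big_ord_recr. Qed.

Lemma ffactFS t k : ffactF t k.+1 = t * ffactF (t - 1) k.
Proof.
rewrite /ffactF big_ord_recl subr0; congr (_ * _); apply: eq_bigr => i _.
by rewrite /= /bump add1n -natr1; ring.
Qed.

Lemma ffactFD t k l : ffactF t (k + l) = ffactF t k * ffactF (t - k%:R) l.
Proof.
rewrite /ffactF big_split_ord; congr (_ * _); apply: eq_bigr => i _.
by rewrite /= natrD; ring.
Qed.

(** Reversing the order of the factors; this is the source of the binomials in [n - t] and
    [n - 1 - t]. *)
Lemma ffactF_refl t k : ffactF t k = (-1) ^+ k * ffactF (k%:R - 1 - t) k.
Proof.
have -> : (-1) ^+ k = \prod_(i < k) -1 :> F by rewrite prodr_const card_ord.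
rewrite /ffactF (reindex_inj rev_ord_inj) -big_split; apply: eq_bigr => i _ /=.
by rewrite natrB // -natr1; ring.
Qed.

(* The regularisation of [- \int_0^1 p(u) u^(-t-1) du], so that
   ['X^m * (1 - 'X)^l] is sent to a Beta value. *)
Definition mellin n t p := \sum_(i < n.+1) p`_i / (t - i%:R).

Lemma mellinD n t p q : mellin n t (p + q) = mellin n t p + mellin n t q.
Proof.
by rewrite /mellin -big_split; apply: eq_bigr => i _; rewrite coefD mulrDl.
Qed.

Lemma mellinZ n t c p : mellin n t (c *: p) = c * mellin n t p.
Proof.
by rewrite /mellin mulr_sumr; apply: eq_bigr => i _; rewrite coefZ mulrA.
Qed.

Lemma mellinB n t p q : mellin n t (p - q) = mellin n t p - mellin n t q.
Proof. by rewrite -scaleN1r mellinD mellinZ mulN1r. Qed.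

Lemma mellin_sum n t m (c : 'I_m -> F) (p : 'I_m -> {poly F}) :
  mellin n t (\sum_(k < m) c k *: p k) = \sum_(k < m) c k * mellin n t (p k).
Proof.
rewrite /mellin; under [RHS]eq_bigr => k _ do rewrite mulr_sumr.
rewrite exchange_big; apply: eq_bigr => i _ /=.
rewrite coef_sum mulr_suml; apply: eq_bigr => k _.
by rewrite coefZ mulrA.
Qed.

Lemma mellinXn n t m : (m <= n)%N -> mellin n t 'X^m = (t - m%:R)^-1.
Proof.
move=> mn; have mn1 : (m < n.+1)%N by [].
rewrite /mellin (bigD1 (Ordinal mn1)) //= coefXn eqxx mul1r big1 ?addr0 // => i im.
by rewrite -val_eqE /= in im; rewrite coefXn (negPf im) mul0r.
Qed.

Variables (n : nat) (t : F).
Hypothesis ht : forall k, (k <= n)%N -> t != k%:R.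

(** Induction on [l] through [1 - 'X], as for the Beta integral. *)
Lemma mellin_beta m l : (m + l <= n)%N ->
  ffactF (t - m%:R) l.+1 * mellin n t ('X^m * (1 - 'X) ^+ l) =
  (-1) ^+ l * l`!%:R.
Proof.
elim: l m => [|l IH] m mln.
  rewrite expr0 mulr1 mellinXn ?ffactFS ?ffactF0; last by rewrite -[m]addn0.
  by rewrite mulr1 divff ?mulr1 // subr_eq0 ht // -[m]addn0.
have hm1 := IH m.+1; rewrite addSnnS in hm1.
have {IH} hm := IH m (leq_trans (leq_add (leqnn _) (leqnSn _)) mln).
rewrite [X in mellin _ _ X](_ : _ = 'X^m * (1 - 'X) ^+ l -
  'X^(m.+1) * (1 - 'X) ^+ l); last by rewrite !exprS; ring.
(* Common denominator of the two values: the first lacks the last factor, the second lacks the first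
   one, and the difference of these factors is [- (l + 1)]. *)
have -> : ffactF (t - m%:R) l.+2 * mellin n t ('X^m * (1 - 'X) ^+ l -
    'X^(m.+1) * (1 - 'X) ^+ l) =
  (t - m%:R - l.+1%:R) * (ffactF (t - m%:R) l.+1 *
     mellin n t ('X^m * (1 - 'X) ^+ l)) -
  (t - m%:R) * (ffactF (t - m.+1%:R) l.+1 *
     mellin n t ('X^(m.+1) * (1 - 'X) ^+ l)).
  have -> : t - m.+1%:R = t - m%:R - 1 by rewrite -natr1; ring.
  rewrite mellinB mulrBr {1}ffactFSr [X in _ - X * _]ffactFS; ring.
by rewrite hm hm1 // factS natrM exprS -natr1; ring.
Qed.

(** The [N] factors split into three blocks: the first [m] stay, the next [l + 1] are used up by
    [mellin_beta], and the last [r] are reflected. *)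
Lemma mellin_beta_ffact N m l r : (m + l <= n)%N -> N = (m + l.+1 + r)%N ->
  ffactF t N * mellin n t ('X^m * (1 - 'X) ^+ l) =
  (-1) ^+ (l + r) * l`!%:R * ffactF t m * ffactF (N%:R - 1 - t) r.
Proof.
move=> mln ->; rewrite !ffactFD.
rewrite [X in X * _ = _](_ : _ = ffactF t m * ffactF (t - (m + l.+1)%:R) r *
  ffactF (t - m%:R) l.+1); last by ring.
rewrite -mulrA mellin_beta // [ffactF (_ - (m + l.+1)%:R) r]ffactF_refl exprD.
rewrite [r%:R - 1 - _](_ : _ = (m + l.+1 + r)%:R - 1 - t); first by ring.
by rewrite !natrD; ring.
Qed.

Lemma ffactF_mellin_beta1 m l : (m + l).+1 = n ->
  ffactF t n * mellin n t ('X^m * (1 - 'X) ^+ l) =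
  (-1) ^+ l * l`!%:R * ffactF t m.
Proof.
move=> E; rewrite (@mellin_beta_ffact _ m l 0) ?ffactF0 ?addn0 ?mulr1 //.
  by rewrite -E.
by rewrite addnS.
Qed.

(** * The three identities, by applying the functional *)

Lemma binomz_sum_eul_eul x y z : (0 < n)%N -> x + y + z = 1 ->
  (-1) ^+ n / 2 * \sum_(k < n) binomz t k * euler_poly k x * euler_poly (n.-1 - k) y
   = (n%:R - t)^-1 * \sum_(k < n.+1) binomz (n%:R - t) k * bernoulli_poly k x * euler_poly (n - k) z
     + binomz t n * \sum_(k < n.+1) ('C(n, k))%:R * (euler_poly k z / (t - k%:R)) * bernoulli_poly (n - k) y.
Proof.
move=> n0 xyz.
have tn : t - n%:R != 0 by rewrite subr_eq0 ht.
have /(congr1 (fun p => ffactF t n * mellin n t p)) :=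
  poly_eul_eul_antidiag _ _ _ _ n0 xyz.
rewrite mellinZ mellinB !mellin_sum mulrCA mulrBr !mulr_sumr => h.
apply: (@mulfI _ 2); first by rewrite pnatr_eq0.
transitivity (\sum_(i < n)
  ffactF t n * ((-1) ^+ i.+1 * euler_poly i x * euler_poly (n.-1 - i) y /
     (i`!%:R * (n.-1 - i)`!%:R) * mellin n t ('X^i * (1 - 'X) ^+ (n.-1 - i)))).
  rewrite mulr_sumr; apply: eq_bigr => k _.
  have kn : (k + (n.-1 - k)).+1 = n.
    by rewrite subnKC ?prednK // -ltnS prednK.
  rewrite [RHS]mulrCA ffactF_mellin_beta1 // -[in (-1) ^+ n]kn binomzE !exprS exprD.
  by field; rewrite !fact_neq0.
rewrite h; congr (_ * _); rewrite [RHS]addrC; congr (_ + _).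
  (* The target indexes this sum by the Euler polynomial, hence the reversal. *)
  rewrite [LHS](reindex_inj rev_ord_inj) /=.
  apply: eq_bigr => k _; have kn : (k <= n)%N by rewrite -ltnS.
  rewrite subSS (subKn kn) (mellinXn _ _ _ kn) (bin_factF _ _ kn) binomzE.
  have := fact_neq0 (F := F) n.
  have := fact_neq0 (F := F) k; have := fact_neq0 (F := F) (n - k).
  have : t - k%:R != 0 by rewrite subr_eq0 ht // -ltnS.
  move: (_ - k%:R) n`!%:R k`!%:R (n - k)`!%:R => u v w r u0 r0 w0 v0.
  by field; rewrite u0 v0 w0 r0.
rewrite -sumrN; apply: eq_bigr => k _.
have kn : (k <= n)%N by rewrite -ltnS.
(* The power [n - k] together with [k] reflected factors takes [n + 1] factors, one more than
   [ffactF t n] has; the extra [t - n] becomes the prefactor [1 / (n - t)]. *)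
have := @mellin_beta_ffact n.+1 0 (n - k) k.
rewrite add0n leq_subr addSn subnK // expr0 mul1r => /(_ isT erefl).
rewrite ffactF0 mulr1 -natr1 addrK ffactFSr => hk.
apply: (mulfI tn).
set M := mellin _ _ _ in hk *.
transitivity (- ((-1) ^+ n * bernoulli_poly k x * euler_poly (n - k) z /
  (k`!%:R * (n - k)`!%:R) * (ffactF t n * (t - n%:R) * M))); first by ring.
rewrite hk binomzE [RHS]mulrA -[n%:R - t]opprB invrN mulrN divff //.
have sgn : (-1) ^+ n * (-1) ^+ n = 1 :> F by rewrite -expr2 sqrr_sign.
have := fact_neq0 (F := F) k; have := fact_neq0 (F := F) (n - k).
move: k`!%:R (n - k)`!%:R => w r r0 w0.
transitivity (- ((-1) ^+ n * (-1) ^+ n * bernoulli_poly k x *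
  euler_poly (n - k) z * ffactF (- (t - n%:R)) k / w)); first by field; rewrite w0 r0.
by rewrite sgn; ring.
Qed.

(** Turns the geometric sums into the harmonic-type ones; [f] will be the identity or the
    successor. *)
Lemma mellin_sumX (f : nat -> nat) m : (forall k, (k < m)%N -> (f k <= n)%N) ->
  mellin n t (\sum_(k < m) 'X^(f k)) = \sum_(k < m) (t - (f k)%:R)^-1.
Proof.
move=> hf; rewrite (eq_bigr (fun k : 'I_m => 1 *: 'X^(f k))); last first.
  by move=> k _; rewrite scale1r.
by rewrite mellin_sum; apply: eq_bigr => k _; rewrite mul1r mellinXn ?hf.
Qed.

Lemma bin_sum_eul_eul x y z : (0 < n)%N -> x + y + z = 1 ->
   n%:R / 2 * binomz t n * \sum_(k < n) ('C(n.-1, k))%:R * (euler_poly k x / (t - k%:R)) * euler_poly (n.-1 - k) y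
     - (-1) ^+ n * euler_poly n z * binomz t n * \sum_(k < n) (t - k%:R)^-1
   = (-1) ^+ n * \sum_(1 <= k < n.+1) binomz t (n - k) * (bernoulli_poly k y / k%:R) * euler_poly (n - k) z
     - \sum_(1 <= k < n.+1) binomz (n.-1%:R - t) (n - k) * (bernoulli_poly k x / k%:R) * euler_poly (n - k) z.
Proof.
move=> n0 xyz.
have /(congr1 (fun p => ffactF t n * mellin n t p)) :=
  poly_eul_eul _ _ _ _ n0 xyz.
rewrite mellinZ !mellinB mellinZ !mellin_sum (mellin_sumX (fun k => k));
  last by move=> k /ltnW.
set S0 := \sum_(k < n) _ * mellin n t 'X^_; set S1 := \sum_(k < n) (_ - _)^-1.
set S2 := \sum_(k < n) _ * mellin n t ('X^_ * _).
set S3 := \sum_(k < n) _ * mellin n t ((1 - 'X) ^+ _) => h.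
have n1k (k : 'I_n) : (k + (n - k.+1))%N = n.-1.
  by rewrite -[in RHS](subnKC (ltn_ord k)) addSn.
have E0 : n%:R / 2 * binomz t n * \sum_(k < n) 'C(n.-1, k)%:R *
    (euler_poly k x / (t - k%:R)) * euler_poly (n.-1 - k) y =
    2^-1 * (ffactF t n * S0).
  rewrite !mulr_sumr; apply: eq_bigr => k _.
  have kn : (k <= n.-1)%N by rewrite -ltnS prednK.
  rewrite (mellinXn _ _ _ (ltnW (ltn_ord k))) (bin_factF _ _ kn) binomzE.
  have -> : n`!%:R = n%:R * n.-1`!%:R :> F by rewrite -natrM -{1 2}(prednK n0) factS.
  have := fact_neq0 (F := F) n.-1.
  have := fact_neq0 (F := F) k; have := fact_neq0 (F := F) (n.-1 - k).
  have : t - k%:R != 0 by rewrite subr_eq0 ht // ltnW.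
  have : n%:R != 0 :> F by rewrite pnatr_eq0 -lt0n.
  move: n%:R (t - k%:R) n.-1`!%:R k`!%:R (n.-1 - k)`!%:R => m u v w r m0 u0 r0 w0 v0.
  by field; rewrite m0 u0 v0 w0 r0.
rewrite E0 h !big_add1 /= !big_mkord.
have -> : (-1) ^+ n * \sum_(k < n) binomz t (n - k.+1) *
    (bernoulli_poly k.+1 y / k.+1%:R) * euler_poly (n - k.+1) z =
    - (ffactF t n * S2).
  rewrite !mulr_sumr -sumrN; apply: eq_bigr => k _.
  rewrite [in RHS]mulrCA ffactF_mellin_beta1; last by rewrite addnC n1k prednK.
  rewrite -[in (-1) ^+ n](prednK n0) -[in (-1) ^+ n.-1.+1](n1k k).
  rewrite exprS exprD binomzE factS natrM.
  have := fact_neq0 (F := F) k; have := fact_neq0 (F := F) (n - k.+1).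
  have : k.+1%:R != 0 :> F by rewrite pnatr_eq0.
  move: k.+1%:R k`!%:R (n - k.+1)`!%:R => m w r m0 r0 w0.
  by field; rewrite m0 w0 r0.
have -> : \sum_(k < n) binomz (n.-1%:R - t) (n - k.+1) *
    (bernoulli_poly k.+1 x / k.+1%:R) * euler_poly (n - k.+1) z =
    ffactF t n * S3.
  rewrite !mulr_sumr; apply: eq_bigr => k _.
  (* No factor precedes the Beta block, so the remaining [n - k - 1] are all reflected, which yields
     the binomial in [n - 1 - t]. *)
  have := @mellin_beta_ffact n 0 k (n - k.+1).
  rewrite !add0n (ltnW (ltn_ord k)) subnKC // expr0 mul1r => /(_ isT erefl) hk.
  rewrite [RHS]mulrCA hk n1k ffactF0 mulr1.
  have -> : n%:R - 1 = n.-1%:R :> F by rewrite -{1}(prednK n0) -natr1 addrK.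
  rewrite binomzE factS natrM mulrA.
  have sgn : (-1) ^+ n.-1 * (-1) ^+ n.-1 = 1 :> F by rewrite -expr2 sqrr_sign.
  have := fact_neq0 (F := F) k; have := fact_neq0 (F := F) (n - k.+1).
  have : k.+1%:R != 0 :> F by rewrite pnatr_eq0.
  move: k.+1%:R k`!%:R (n - k.+1)`!%:R => m w r m0 r0 w0.
  rewrite -[LHS]mul1r -[X in X * _ = _]sgn.
  by field; rewrite m0 w0 r0.
by rewrite binomzE; field; rewrite fact_neq0.
Qed.

Lemma bin_sum_ber_ber x y z : (0 < n)%N -> x + y + z = 1 ->
   (-1) ^+ n.-1 / n%:R * binomz (t - 1) n.-1 * \sum_(k < n.+1) ('C(n, k))%:R * (bernoulli_poly k x / (t - k%:R)) * bernoulli_poly (n - k) y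
     - bernoulli_poly n z / n%:R * binomz (t - 1) n.-1 * \sum_(1 <= k < n) (t - k%:R)^-1
   = t^-1 * \sum_(1 <= k < n.+1) binomz t (n - k) * (bernoulli_poly k y / k%:R) * bernoulli_poly (n - k) z
     + (-1) ^+ n / (n%:R - t) * \sum_(1 <= k < n.+1) binomz (n%:R - t) (n - k) * (bernoulli_poly k x / k%:R) * bernoulli_poly (n - k) z.
Proof.
move=> n0 xyz.
have t0 : t != 0 by have := ht 0 isT.
have tn : t - n%:R != 0 by rewrite subr_eq0 ht.
have nF : n%:R != 0 :> F by rewrite pnatr_eq0 -lt0n.
have fn : n`!%:R = n%:R * n.-1`!%:R :> F by rewrite -natrM -{1 2}(prednK n0) factS.
have fn0 := fact_neq0 (F := F) n.-1.
have sgn : (-1) ^+ n.-1 * (-1) ^+ n.-1 = 1 :> F by rewrite -expr2 sqrr_sign.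
have sgnS : (-1) ^+ n = - (-1) ^+ n.-1 :> F by rewrite -{1}(prednK n0) exprS mulN1r.
have n1k (k : 'I_n) : (k + (n - k.+1))%N = n.-1.
  by rewrite -[in RHS](subnKC (ltn_ord k)) addSn.
have /(congr1 (mellin n t)) := poly_ber_ber _ _ _ _ n0 xyz.
rewrite mellinB mellinD mellinZ !mellin_sum (mellin_sumX S); last first.
  by move=> k; rewrite -ltnS prednK // => /ltnW.
set S0 := \sum_(k < n.+1) _ * mellin n t 'X^_; set S1 := \sum_(k < _) (_ - _)^-1.
set S2 := \sum_(k < n) _ * mellin n t ('X^1 * _).
set S3 := \sum_(k < n) _ * mellin n t ('X^(n - _) * _) => h.
(* The multiplier for this identity: [ffactF t n] without its factor [t], which accounts for the
   prefactor [1 / t]. *)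
pose G := ffactF (t - 1) n.-1.
have GE : ffactF t n = t * G by rewrite /G -ffactFS prednK.
have E0 : (-1) ^+ n.-1 / n%:R * binomz (t - 1) n.-1 * \sum_(k < n.+1)
    'C(n, k)%:R * (bernoulli_poly k x / (t - k%:R)) * bernoulli_poly (n - k) y =
    (-1) ^+ n.-1 * G * S0.
  rewrite !mulr_sumr; apply: eq_bigr => k _.
  have kn : (k <= n)%N by rewrite -ltnS.
  rewrite (mellinXn _ _ _ kn) (bin_factF _ _ kn) binomzE -/G fn.
  have := fact_neq0 (F := F) k; have := fact_neq0 (F := F) (n - k).
  have : t - k%:R != 0 by rewrite subr_eq0 ht.
  move: n%:R (t - k%:R) n.-1`!%:R k`!%:R (n - k)`!%:R nF fn0 => m u v w r m0 v0 u0 r0 w0.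
  by field; rewrite m0 u0 v0 w0 r0.
rewrite E0 h !big_add1 /= !big_mkord -/S1.
have -> : t^-1 * \sum_(k < n) binomz t (n - k.+1) *
    (bernoulli_poly k.+1 y / k.+1%:R) * bernoulli_poly (n - k.+1) z =
    (-1) ^+ n.-1 * G * S3.
  rewrite !mulr_sumr; apply: eq_bigr => k _.
  have : (n - k.+1 + k).+1 = n by rewrite addnC n1k prednK.
  move=> /ffactF_mellin_beta1; rewrite GE; set M := mellin _ _ _ => hk.
  apply: (mulfI t0); rewrite mulVKf //.
  rewrite [RHS](_ : _ = (-1) ^+ n.-1 * ((-1) ^+ (n - k.+1) *
    bernoulli_poly k.+1 y * bernoulli_poly (n - k.+1) z /
    (k.+1`!%:R * (n - k.+1)`!%:R)) * (t * G * M)); last by ring.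
  have sk : (-1) ^+ k * (-1) ^+ (n - k.+1) = (-1) ^+ n.-1 :> F.
    by rewrite -exprD n1k.
  rewrite hk binomzE factS natrM -[LHS]mul1r -[X in X * _ = _]sgn.
  rewrite -[X in X * _ * _ = _]sk.
  have := fact_neq0 (F := F) k; have := fact_neq0 (F := F) (n - k.+1).
  have : k.+1%:R != 0 :> F by rewrite pnatr_eq0.
  move: k.+1%:R k`!%:R (n - k.+1)`!%:R => m w r m0 r0 w0.
  by field; rewrite m0 w0 r0.
have -> : (-1) ^+ n / (n%:R - t) * \sum_(k < n) binomz (n%:R - t) (n - k.+1) *
    (bernoulli_poly k.+1 x / k.+1%:R) * bernoulli_poly (n - k.+1) z =
    (-1) ^+ n.-1 * G * S2.
  rewrite !mulr_sumr; apply: eq_bigr => k _.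
  (* Uses [ffactF t n.+1 = t * G * (t - n)]: the leading [t] is the block before the Beta factors
     and cancels, while [t - n] yields [1 / (n - t)]. *)
  have := @mellin_beta_ffact n.+1 1 k (n - k.+1).
  rewrite !add1n ltn_ord addSn subnKC // => /(_ isT erefl).
  rewrite n1k -natr1 addrK ffactFSr GE ffactFS ffactF0 mulr1.
  set M := mellin _ _ _ => hk.
  apply: (mulfI tn); apply: (mulfI t0).
  rewrite [RHS](_ : _ = (-1) ^+ n.-1 * ((-1) ^+ n.-1 *
    bernoulli_poly k.+1 x * bernoulli_poly (n - k.+1) z /
    (k.+1`!%:R * (n - k.+1)`!%:R)) * (t * G * (t - n%:R) * M)); last by ring.
  rewrite hk binomzE factS natrM sgnS.
  rewrite [RHS](_ : _ = ((-1) ^+ n.-1 * (-1) ^+ n.-1) * (-1) ^+ n.-1 *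
    bernoulli_poly k.+1 x * bernoulli_poly (n - k.+1) z * k`!%:R * t *
    ffactF (n%:R - t) (n - k.+1) / (k.+1%:R * k`!%:R * (n - k.+1)`!%:R));
    last by ring.
  rewrite sgn -[n%:R - t]opprB.
  have := fact_neq0 (F := F) k; have := fact_neq0 (F := F) (n - k.+1).
  have : k.+1%:R != 0 :> F by rewrite pnatr_eq0.
  move: (t - n%:R) tn k.+1%:R k`!%:R (n - k.+1)`!%:R => u u0 m w r m0 r0 w0.
  by field; rewrite m0 w0 r0 u0.
rewrite binomzE -/G fn sgnS.
rewrite -[bernoulli_poly n z / n%:R]mul1r.
rewrite -[X in X * (bernoulli_poly n z / n%:R)]sgn.
move: n%:R n.-1`!%:R nF fn0 => m v m0 v0.
by field; rewrite m0 v0.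
Qed.

End BetaFunctional.

Theorem theorem1p3 (R : realType) (n : nat) (x y z t : R[i])
  (hn : (0 < n)%N) (hxyz : x + y + z = 1)
  (ht : forall k : nat, (k <= n)%N -> t != k%:R) :
  [/\
   (-1) ^+ n / 2 * \sum_(k < n) binomz t k * euler_poly k x * euler_poly (n.-1 - k) y
   = (n%:R - t)^-1 * \sum_(k < n.+1) binomz (n%:R - t) k * bernoulli_poly k x * euler_poly (n - k) z
     + binomz t n * \sum_(k < n.+1) ('C(n, k))%:R * (euler_poly k z / (t - k%:R)) * bernoulli_poly (n - k) y,

   n%:R / 2 * binomz t n * \sum_(k < n) ('C(n.-1, k))%:R * (euler_poly k x / (t - k%:R)) * euler_poly (n.-1 - k) y
     - (-1) ^+ n * euler_poly n z * binomz t n * \sum_(k < n) (t - k%:R)^-1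
   = (-1) ^+ n * \sum_(1 <= k < n.+1) binomz t (n - k) * (bernoulli_poly k y / k%:R) * euler_poly (n - k) z
     - \sum_(1 <= k < n.+1) binomz (n.-1%:R - t) (n - k) * (bernoulli_poly k x / k%:R) * euler_poly (n - k) z
   &
   (-1) ^+ n.-1 / n%:R * binomz (t - 1) n.-1 * \sum_(k < n.+1) ('C(n, k))%:R * (bernoulli_poly k x / (t - k%:R)) * bernoulli_poly (n - k) y
     - bernoulli_poly n z / n%:R * binomz (t - 1) n.-1 * \sum_(1 <= k < n) (t - k%:R)^-1
   = t^-1 * \sum_(1 <= k < n.+1) binomz t (n - k) * (bernoulli_poly k y / k%:R) * bernoulli_poly (n - k) z
     + (-1) ^+ n / (n%:R - t) * \sum_(1 <= k < n.+1) binomz (n%:R - t) (n - k) * (bernoulli_poly k x / k%:R) * bernoulli_poly (n - k) z ].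
Proof.
split; [exact: binomz_sum_eul_eul | exact: bin_sum_eul_eul | exact: bin_sum_ber_ber].
Qed.
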